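(* Let $\mathbf{A}\in\mathbb{R}^{kM\times M}$ be the Hankel matrix of one step of the iteration described in the context, $A_{ij}=a_{i+j}$ ($0\le i<kM$, $0\le j<M$), let $\mathbf{H}_0,\dots,\mathbf{H}_{k-1}\in\mathbb{R}^{M\times M}$ be its consecutive square Hankel blocks, $(\mathbf{H}_m)_{ij}=a_{mM+i+j}$, so that $\mathbf{A}^T=(\mathbf{H}_0,\mathbf{H}_1,\dots,\mathbf{H}_{k-1})$, and let $\mathcal{H}$ be the linear span of $\{\mathbf{H}_m\}_{m=0}^{k-1}$. Let $\{\mathbf{u}_i\}_{i=0}^{r-1}$ be a basis of the linear span of $\{\mathbf{l}_m\}_{m=0}^{k}$, where $\mathbf{l}_m=(a_{mM},a_{mM+1},\dots,a_{mM+M-1})^T$, let $\mathbf{w}_i\in\mathbb{R}^{M-1}$ consist of the first $M-1$ entries of $\mathbf{u}_i$, and let $$\mathbf{Q}_i=\begin{cases}\mathbf{U}_i=[\mathbf{u}_i^T,\mathbf{0}]_H, & 0\le i<r,\\ \mathbf{W}_{i-r}=[\mathbf{0}^T,\mathbf{w}_{i-r}]_H, & r\le i<2r.\end{cases}$$ Let the set $\{\mathbf{Q}_i\}_{i=0}^{2r-1}$ be a basis set of the linear span $\mathcal{H}$. Then the computation of any $K_s$ elements $s_i$ of the vector $\mathbf{s}=\mathbf{A}\mathbf{p}$ costs $\mathcal{O}(rM\log M+r^2M)$ flops for $K_s=\mathcal{O}(rM)$.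
   Context: Vectors are columns and indices of vector and matrix entries start at $0$. For $\mathbf{a}=(a_0,\dots,a_{M-1})^T\in\mathbb{R}^M$ and $\mathbf{b}=(b_0,\dots,b_{M-2})^T\in\mathbb{R}^{M-1}$, $[\mathbf{a}^T,\mathbf{b}]_H$ denotes the $M\times M$ Hankel matrix whose $(i,j)$ entry is $a_{i+j}$ if $i+j\le M-1$ and $b_{i+j-M}$ if $i+j\ge M$. The iteration. Let $n\ge1$, $T>0$, $\delta t=T/n$, $\tau_k=k\,\delta t$, $\sigma>0$, $\lambda=1/(4\sigma\,\delta t)$. Let $f:\mathbb{R}\to\mathbb{R}^+$ be an initial distribution and $V(x,t)$ a potential bounded from below (data of the equation $\partial_t u=\sigma\,\partial_x^2u-Vu$, $u(x,0)=f(x)$, $t\in[0,T]$). Let $w_0,\dots,w_n$ be weights of a time quadrature rule and $\mu_0,\dots,\mu_{M-1}$ weights of a spatial quadrature rule. Let $a_x>0$, $N_x$ a positive integer, $M=2N_x$, $h_x=a_x/N_x$, and define the meshes $x^{(k)}_i=-ka_x+ih_x$ ($0\le i<kM$) and $\xi_j=-a_x+jh_x$ ($0\le j<M$), so that $x^{(k+1)}_{i+j}=x^{(k)}_i+\xi_j$. Starting from $\tilde F_{n+1}=f$, for $k=n,n-1,\dots,1$ put $$\tilde\Phi_{k+1}(x^{(k+1)}_i)=\tilde F_{k+1}(x^{(k+1)}_i)\,e^{-w_kV(x^{(k+1)}_i,\tau_{n-k})\,\delta t},\qquad \tilde F_k(x^{(k)}_i)=\sum_{j=0}^{M-1}\mu_j\,\tilde\Phi_{k+1}(x^{(k+1)}_{i+j})\,p(\lambda,\xi_j),\qquad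 p(\lambda,\xi)=\sqrt{\lambda/\pi}\,e^{-\lambda\xi^2}.$$ For a fixed step $k$, put $a_i=\tilde\Phi_{k+1}(x^{(k+1)}_i)$ for $0\le i<(k+1)M$, $p_j=\mu_j\,p(\lambda,\xi_j)$ and $\mathbf{p}=(p_0,\dots,p_{M-1})^T$; then $\mathbf{s}=\mathbf{A}\mathbf{p}\in\mathbb{R}^{kM}$ has entries $s_i=\tilde F_k(x^{(k)}_i)$. ''Flops'' means floating-point operations. *)

(* Defs.v *)
From HB Require Import structures.
From mathcomp Require Import all_boot all_order all_algebra.
From mathcomp Require Import all_classical all_reals all_analysis.
Set Implicit Arguments.
Unset Strict Implicit.
Unset Printing Implicit Defensive.
Import Order.TTheory GRing.Theory Num.Theory.
Local Open Scope ring_scope.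

Section Hankel.
Variable R : realType.

(* Entry [l] of a column vector; the value 0 for [l] out of range is never
   reached by [hankel]. *)
Definition centry (m : nat) (v : 'cV[R]_m) (l : nat) : R :=
  if insub l is Some i then v i 0 else 0.

(* The matrix [a^T, b]_H. *)
Definition hankel (M : nat) (a : 'cV[R]_M) (b : 'cV[R]_(M.-1)) : 'M[R]_M :=
  \matrix_(i, j) if (i + j <= M.-1)%N then centry a (i + j)
                 else centry b (i + j - M).

Definition hankel_rect (k M : nat) (a : nat -> R) : 'M[R]_(k * M, M) :=
  \matrix_(i, j) a (i + j)%N.

Definition hankel_block (M : nat) (a : nat -> R) (m : nat) : 'M[R]_M :=
  \matrix_(i, j) a (m * M + i + j)%N.

Definition segment (M : nat) (a : nat -> R) (m : nat) : 'cV[R]_M :=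
  \col_i a (m * M + i)%N.

Definition block_span (k M : nat) (a : nat -> R) : {vspace 'M[R]_M} :=
  <<[seq hankel_block M a m | m <- iota 0 k]>>%VS.

Definition segment_span (k M : nat) (a : nat -> R) : {vspace 'cV[R]_M} :=
  <<[seq segment M a m | m <- iota 0 k.+1]>>%VS.

Definition drop_last (M : nat) (u : 'cV[R]_M) : 'cV[R]_(M.-1) :=
  \col_j u (widen_ord (leq_pred M) j) 0.

(* Q_0, ..., Q_(2r-1): first the U_i, then the W_i. *)
Definition Qfamily (M r : nat) (u : r.-tuple 'cV[R]_M) : seq 'M[R]_M :=
  [seq hankel v 0 | v <- u] ++ [seq hankel 0 (drop_last v) | v <- u].

End Hankel.

Section Iteration.
Variable R : realType.

Definition mesh (ax : R) (Nx k i : nat) : R :=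
  - (k%:R * ax) + i%:R * (ax / Nx%:R).

Definition xi (ax : R) (Nx j : nat) : R := - ax + j%:R * (ax / Nx%:R).

Definition heat (lambda y : R) : R :=
  Num.sqrt (lambda / pi) * expR (- (lambda * y ^+ 2)).

Definition dt (T : R) (n : nat) : R := T / n%:R.
Definition tau (T : R) (n k : nat) : R := k%:R * dt T n.
Definition lam (T sigma : R) (n : nat) : R := (4 * sigma * dt T n)^-1.

Definition potential_bounded_below (T : R) (V : R -> R -> R) : Prop :=
  exists b, forall x t, 0 <= t <= T -> b <= V x t.

(* [F k] and [Phi k] are only constrained on the mesh points of level [k];
   these are pairwise distinct for [0 < ax], so the recurrence has a solution,
   unique on the meshes. *)
Definition iteration (n : nat) (T sigma : R) (f : R -> R) (V : R -> R -> R)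
    (w : 'I_n.+1 -> R) (M Nx : nat) (mu : 'I_M -> R) (ax : R)
    (F Phi : nat -> R -> R) : Prop :=
  let x := mesh ax Nx in
  [/\ forall i, (i < n.+1 * M)%N -> F n.+1 (x n.+1 i) = f (x n.+1 i),
      forall (k : 'I_n.+1) i, (0 < k)%N -> (i < k.+1 * M)%N ->
        Phi k.+1 (x k.+1 i) =
        F k.+1 (x k.+1 i)
        * expR (- (w k * V (x k.+1 i) (tau T n (n - k)) * dt T n))
    & forall (k : 'I_n.+1) i, (0 < k)%N -> (i < k * M)%N ->
        F k (x k i) =
        \sum_(j < M) mu j * Phi k.+1 (x k.+1 (i + j)%N)
                     * heat (lam T sigma n) (xi ax Nx j)].

Definition step_data (Phi : nat -> R -> R) (ax : R) (Nx k i : nat) : R :=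
  Phi k.+1 (mesh ax Nx k.+1 i).

Definition kernel_vec (T sigma : R) (n M Nx : nat) (mu : 'I_M -> R) (ax : R) :
    'cV[R]_M :=
  \col_j (mu j * heat (lam T sigma n) (xi ax Nx j)).

Lemma hankel_rect_mul_kernel_vec (n : nat) (T sigma : R) (f : R -> R)
    (V : R -> R -> R) (w : 'I_n.+1 -> R) (M Nx : nat) (mu : 'I_M -> R)
    (ax : R) (F Phi : nat -> R -> R) (k : nat) (i : 'I_(k * M)) :
  iteration T sigma f V w Nx mu ax F Phi -> (0 < k <= n)%N ->
  (hankel_rect k M (step_data Phi ax Nx k)
     *m kernel_vec T sigma n Nx mu ax) i 0
  = F k (mesh ax Nx k i).
Proof.
move=> [_ _ HF] /andP[k0 kn].
have kn1 : (k < n.+1)%N by [].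
rewrite (HF (Ordinal kn1) i k0 (ltn_ord i)) mxE; apply: eq_bigr => j _ /=.
by rewrite !mxE mulrCA mulrA.
Qed.

End Iteration.

(* Flop counting: exact real arithmetic with random-access registers.  A
   program is loop-free, so it is written for one problem size; it may contain
   real constants (such as FFT twiddle factors), which cannot depend on the
   input values.  Each arithmetic operation and each zero test costs one flop;
   reading an input, a constant or a register is free.  Division by zero makes
   the execution fail, since the library's [x / 0 = 0] would otherwise provide
   an unintended branching primitive. *)
Section FlopModel.
Variables (R : realType) (I : Type).

Inductive arith := Add | Sub | Mul | Div.

Inductive operand := Const of R | Reg of nat | Input of I.

Inductive program :=
  | Skip
  | Assign of nat & arith & operand & operand
  | Seq of program & program
  | IfZero of operand & program & program.

Definition arith_eval (o : arith) (x y : R) : option R :=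
  match o with
  | Add => Some (x + y)
  | Sub => Some (x - y)
  | Mul => Some (x * y)
  | Div => if y == 0 then None else Some (x / y)
  end.

Definition operand_eval (inp : I -> R) (mem : nat -> R) (x : operand) : R :=
  match x with Const c => c | Reg d => mem d | Input i => inp i end.

Definition update (mem : nat -> R) (d : nat) (v : R) : nat -> R :=
  fun e => if e == d then v else mem e.

(* Final register contents and number of flops spent. *)
Fixpoint exec (inp : I -> R) (P : program) (mem : nat -> R) :
    option ((nat -> R) * nat) :=
  match P with
  | Skip => Some (mem, 0%N)
  | Assign d o x y =>
      if arith_eval o (operand_eval inp mem x) (operand_eval inp mem y)
        is Some v then Some (update mem d v, 1%N) else None
  | Seq P1 P2 =>
      if exec inp P1 mem is Some (mem1, c1) then
        if exec inp P2 mem1 is Some (mem2, c2) then Some (mem2, (c1 + c2)%N)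
        else None
      else None
  | IfZero x P1 P2 =>
      if exec inp (if operand_eval inp mem x == 0 then P1 else P2) mem
        is Some (mem1, c1) then Some (mem1, c1.+1) else None
  end.

(* On input [inp], starting from zeroed registers, [P] succeeds with at most
   [cost] flops, leaving [out j] in register [j]. *)
Definition computes_within (P : program) (inp : I -> R) (K : nat)
    (out : 'I_K -> R) (cost : R) : Prop :=
  exists mem c, [/\ exec inp P (fun=> 0) = Some (mem, c),
                    forall j : 'I_K, mem j = out j & c%:R <= cost].

End FlopModel.

(* The numbers a program may read: the a_i, the entries of the basis vectors
   u_i, and the p_j.  In particular the coordinates of the blocks in the basis
   are not given in advance. *)
Inductive datum (k M r : nat) :=
  | InA of 'I_(k.+1 * M)
  | InU of 'I_r & 'I_M
  | InP of 'I_M.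

Definition datum_val (R : realType) (k M r : nat) (a : nat -> R)
    (u : r.-tuple 'cV[R]_M) (p : 'cV[R]_M) (d : datum k M r) : R :=
  match d with
  | InA i => a i
  | InU i j => tnth u i j 0
  | InP j => p j 0
  end.

(* Main.v *)
Require Import Defs.
From HB Require Import structures.
From mathcomp Require Import all_boot all_order all_algebra.
From mathcomp Require Import all_classical all_reals all_analysis.
From mathcomp Require Import complex.
From mathcomp Require Import zify ring lra.
Set Implicit Arguments.
Unset Strict Implicit.
Unset Printing Implicit Defensive.
Import Order.TTheory GRing.Theory Num.Theory.
Local Open Scope ring_scope.

(* Gaussian elimination on the r basis vectors costs O(r^2 M) flops and yields
   another basis, with v_l(rho_i) = delta_(i l) at some pivots rho_0, ...,
   rho_(r-1).  Hence the coordinates of every segment l_m in the new basis are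
   simply the data a_(mM + rho_l), and no linear system has to be solved per
   requested entry.  The vectors U_l p and W_l p are read off the product of the
   polynomial with coefficients v_l by the reversal of p, and these r products
   cost O(M log M) flops each: a product modulo X^(2n) - s^2 reduces to products
   modulo X^n - s and X^n + s.  Each entry s_(mM + i) is then the sum of the 2r
   terms a_(mM + rho_l) (U_l p)_i and a_((m+1)M + rho_l) (W_l p)_i, i.e. O(r)
   flops for each of the O(rM) entries. *)

(** * Decision trees over quantities, and their compilation into programs *)

Section CostCalculus.
Variables (R : realType) (I : Type).
Local Open Scope classical_set_scope.
Local Notation input := (I -> R).
Local Notation val := (input -> R).

(* [solves out D S c]: on the inputs in [D], a decision tree spending at most
   [c] flops computes all the [out j] from the quantities in [S].  A quantity is
   a function of the input, so no registers have to be tracked. *)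
Inductive solves K (out : 'I_K -> val) : set input -> set val -> nat -> Prop :=
| solves_done D S c of
    (forall j, exists2 v, S v & forall t, D t -> v t = out j t) :
    solves out D S c
| solves_op D S o x y z c of S x & S y &
    (forall t, D t -> arith_eval o (x t) (y t) = Some (z t)) &
    solves out D (S `|` [set z]) c :
    solves out D S c.+1
| solves_if D S x c of S x &
    solves out (D `&` [set t | x t = 0]) S c &
    solves out (D `&` [set t | x t != 0]) S c :
    solves out D S c.+1.

Lemma sub_solves K (out : 'I_K -> val) D D' S S' c c' :
  D' `<=` D -> S `<=` S' -> (c <= c')%N -> solves out D S c -> solves out D' S' c'.
Proof.
move=> sDD' sSS' lecc' sol.
elim: sol D' S' c' sDD' sSS' lecc' => {D S c}
  [D S c outS|D S o x y z c Sx Sy ev _ IH|D S x c Sx _ IH0 _ IH1] D' S' c' sDD' sSS'.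
- move=> _; apply: solves_done => j; have [v /sSS' S'v vE] := outS j.
  by exists v => // t /sDD'/vE.
- case: c' => // c' lecc'; apply: (solves_op (o := o) (z := z) (sSS' _ Sx) (sSS' _ Sy)).
    by move=> t /sDD'/ev.
  exact: IH sDD' (setSU sSS') lecc'.
- case: c' => // c' lecc'; apply: (solves_if (sSS' _ Sx)).
    exact: IH0 (setSI sDD') sSS' lecc'.
  exact: IH1 (setSI sDD') sSS' lecc'.
Qed.

Definition is_reg_in (a b : nat) (x : operand R I) : bool :=
  if x is Reg e then (a <= e < b)%N else true.

(* [G t] is the set of memories in which the program may be started on input
   [t]; the registers below [K] are reserved for the results. *)
Lemma solves_program K (out : 'I_K -> val) D S c :
  solves out D S c ->
  forall (G : input -> set (nat -> R)) d, (K <= d)%N ->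
    (forall v, S v -> exists2 x, is_reg_in K d x &
       forall t mem, D t -> G t mem -> operand_eval t mem x = v t) ->
  exists P : program R I, forall t mem, D t -> G t mem ->
    exists mem' c', [/\ exec t P mem = Some (mem', c'),
      forall j : 'I_K, mem' j = out j t & (c' <= c + K)%N].
Proof.
elim=> {D S c}
  [D S c outS|D S o x y z c Sx Sy ev _ IH|D S x c Sx _ IH0 _ IH1] G d Kd HS.
- have /choice[loc locP] : forall j : 'I_K, exists x, is_reg_in K d x /\
      forall t mem, D t -> G t mem -> operand_eval t mem x = out j t.
    move=> j; have [v /HS[x xd xv] vout] := outS j.
    by exists x; split=> // t mem Dt Gt; rewrite xv ?vout.
  (* The results are copied one by one into the registers below [K]. The sources lie in registers
     from [K] on, in inputs or in constants, so no copy destroys a later source. A copy is an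
     addition of 0 and costs one flop, whence the extra [K]. *)
  suff writes n : (n <= K)%N -> exists P : program R I,
      forall t mem, D t -> G t mem -> exists mem' c',
      [/\ exec t P mem = Some (mem', c'),
        forall j : 'I_K, (j < n)%N -> mem' j = out j t,
        forall e, (K <= e)%N -> mem' e = mem e & (c' <= n)%N].
    have [P HP] := writes K (leqnn K); exists P => t mem Dt Gt.
    have [mem' [c' [ex outE _ c'K]]] := HP t mem Dt Gt.
    by exists mem', c'; split=> // [j|]; [exact: outE|exact: leq_trans (leq_addl _ _)].
  elim: n => [|n IHn] nK.
    by exists (Skip R I) => t mem Dt Gt; exists mem, 0%N.
  have [P HP] := IHn (ltnW nK); pose jn := Ordinal nK.
  exists (Seq P (Assign n Add (loc jn) (Const I 0))) => t mem Dt Gt.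
  have [mem' [c' [ex outE memE c'n]]] := HP t mem Dt Gt.
  have locE : operand_eval t mem' (loc jn) = out jn t.
    have [xd locE] := locP jn; rewrite -(locE t mem Dt Gt).
    by case: (loc jn) xd => //= e /andP[Ke _]; rewrite memE.
  exists (update mem' n (out jn t)), (c' + 1)%N; split=> /=.
  + by rewrite ex locE addr0.
  + move=> j; rewrite ltnS leq_eqVlt /update.
    have [jE _|jn' /= jltn] := eqVneq (j : nat) n; last exact: outE.
    by congr out; apply: val_inj.
  + move=> e Ke; rewrite /update ifN ?memE//.
    by rewrite neq_ltn (leq_trans nK Ke) orbT.
  + by rewrite addn1.
- have [xl xld xlE] := HS _ Sx; have [yl yld yE] := HS _ Sy.
  (* The operation writes to the fresh register [d], so all quantities located so far keep their
     places, and the new one is found in [d]. *)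
  pose G' t := [set mem' | exists2 mem, G t mem & mem' = update mem d (z t)].
  have Gop e mem v t (xx : operand R I) : is_reg_in K d xx -> d = e ->
     operand_eval t (update mem e v) xx = operand_eval t mem xx.
    case: xx => //= e' /andP[_ e'd] <-.
    by rewrite /update ifN// neq_ltn e'd.
  have [|v|P HP] := IH G' d.+1; first exact: leq_trans (leqnSn _).
    move=> [/HS[xx xxd xxE]|->].
      exists xx.
        by case: (xx) xxd => //= e /andP[-> ed] /=; rewrite ltnS ltnW.
      by move=> t mem Dt [mem0 Gt ->]; rewrite Gop // xxE.
    exists (Reg _ _ d); rewrite /= ?Kd ?ltnSn//.
    by move=> t mem Dt [mem0 Gt ->]; rewrite /update eqxx.
  exists (Seq (Assign d o xl yl) P) => t mem Dt Gt.
  have [|mem' [c' [ex outE c'c]]] := HP t (update mem d (z t)) Dt.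
    by exists mem.
  exists mem', (1 + c')%N; split=> //=.
  by rewrite xlE// yE// ev// ex.
- have [xl xld xlE] := HS _ Sx.
  have [v Sv|P0 HP0] := IH0 G d Kd.
    have [xx xxd xxE] := HS v Sv; exists xx => // t mem [Dt _]; exact: xxE.
  have [v Sv|P1 HP1] := IH1 G d Kd.
    have [xx xxd xxE] := HS v Sv; exists xx => // t mem [Dt _]; exact: xxE.
  exists (IfZero xl P0 P1) => t mem Dt Gt /=; rewrite xlE//.
  have [x0|xn0] := eqVneq (x t) 0.
    have [mem' [c' [ex outE c'c]]] := HP0 t mem (conj Dt x0) Gt.
    by exists mem', c'.+1; rewrite ex.
  have [mem' [c' [ex outE c'c]]] := HP1 t mem (conj Dt xn0) Gt.
  by exists mem', c'.+1; rewrite ex.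
Qed.

Definition free_vals : set val :=
  range (@cst input R) `|` range (fun (i : I) (t : input) => t i).

Lemma solves_computes K (out : 'I_K -> val) D c :
  solves out D free_vals c ->
  exists P : program R I, forall t, D t ->
    computes_within P t (fun j => out j t) (c + K)%:R.
Proof.
move=> sol; have [v|P HP] := solves_program sol (G := fun=> [set fun=> 0]) (leqnn K).
  move=> [[a _ <-]|[i _ <-]]; first by exists (Const I a).
  by exists (Input R i).
exists P => t Dt; have [mem [c' [ex outE c'c]]] := HP t _ Dt erefl.
by exists mem, c'; rewrite ler_nat.
Qed.

(** This is the pivot search: the candidates are tested in turn. Only one continuation is executed,
    so [c] is paid once, besides one flop per zero test. *)
Lemma solves_find_nonzero K (out : 'I_K -> val) D S c (T : eqType) (x : T -> val)
    (s : seq T) :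
  (forall i, i \in s -> S (x i)) ->
  solves out (D `&` [set t | forall i, i \in s -> x i t = 0]) S c ->
  (forall i, i \in s -> solves out (D `&` [set t | x i t != 0]) S c) ->
  solves out D S (c + size s).
Proof.
elim: s D => [|i s IH] D Sx sol0 soln0.
  by apply: sub_solves sol0; rewrite ?addn0 // => t Dt; split.
rewrite /= addnS; apply: (solves_if (Sx i (mem_head _ _))); last first.
  apply: sub_solves (soln0 i (mem_head _ _)); rewrite ?leq_addr//.
apply: IH => [j js|| j js].
- by apply: Sx; rewrite in_cons js orbT.
- apply: sub_solves sol0 => // t [[Dt xi0] xs0]; split=> // j.
  by rewrite in_cons => /predU1P[->|/xs0].
- apply: (sub_solves _ _ _ (soln0 j _)); rewrite ?in_cons ?js ?orbT//.
  by move=> t [[]].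
Qed.

(* On the inputs in [D], the quantities in [V] can be computed from those in [S]
   with [c] flops, in continuation-passing style. *)
Definition derives (D : set input) (S V : set val) (c : nat) : Prop :=
  forall K (out : 'I_K -> val) D' S' c', D' `<=` D -> S `<=` S' ->
    solves out D' (S' `|` V) c' -> solves out D' S' (c + c').

Lemma derives_op D S o x y z : S x -> S y ->
  (forall t, D t -> arith_eval o (x t) (y t) = Some (z t)) ->
  derives D S [set z] 1.
Proof.
move=> Sx Sy ev K out D' S' c' sD sS sol.
by apply: (solves_op (o := o) (z := z) (sS _ Sx) (sS _ Sy)) => // t /sD/ev.
Qed.

Lemma derives_sub D S V S' V' c c' : derives D S V c -> S `<=` S' ->
  V' `<=` V `|` S' -> (c <= c')%N -> derives D S' V' c'.
Proof.
move=> der sS sV lec K out D1 S1 c1 sD sS1 sol.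
apply: (@sub_solves _ _ D1 _ S1 _ (c + c1)%N) => //; first by rewrite leq_add2r.
apply: (der K out D1 S1 c1 sD (subset_trans sS sS1)).
apply: sub_solves sol => //; rewrite subUset; split=> v; first by left.
by move=> /sV[Vv|/sS1 S1v]; [right|left].
Qed.

Lemma derives_trans D S V W c c' :
  derives D S V c -> derives D (S `|` V) W c' -> derives D S (V `|` W) (c + c').
Proof.
move=> derV derW K out D1 S1 c1 sD sS1; rewrite setUA => sol.
rewrite -addnA; apply: derV => //; apply: derW => //; exact: setSU.
Qed.

Lemma derives0 D S : derives D S S 0.
Proof.
move=> K out D1 S1 c1 _ sS1; apply: sub_solves => // v []//; exact: sS1.
Qed.

Lemma derives_seq D S (T : Type) (V : T -> set val) c (s : seq T) :
  (forall i, derives D S (V i) c) ->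
  derives D S [set v | exists2 i, List.In i s & V i v] (size s * c).
Proof.
move=> derV; elim: s => [|i s IH] /=.
  by apply: (derives_sub (@derives0 D S) _ _ (leq0n _)) => // v [].
have derI := derives_sub IH (@subsetUl _ S (V i)) (@subsetUl _ _ _) (leqnn _).
apply: (derives_sub (derives_trans (derV i) derI) _ _ _) => // v [j [<-|js] Vv].
  by left; left.
by left; right; exists j.
Qed.

Lemma derives_bigcup D S (T : finType) (V : T -> set val) c :
  (forall i, derives D S (V i) c) ->
  derives D S (\bigcup_i V i) (#|T| * c).
Proof.
move=> derV; have der := derives_seq (s := enum T) derV.
apply: (derives_sub der _ _ _); last by rewrite -cardE.
  exact: subset_refl.
move=> v [i _ Vv]; left; exists i => //.
have : i \in enum T by rewrite mem_enum.
by elim: (enum T) => //= j s IH; rewrite inE => /predU1P[->|/IH]; [left|right].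
Qed.

Lemma derivesU D S V W c c' :
  derives D S V c -> derives D S W c' -> derives D S (V `|` W) (c + c').
Proof.
move=> derV derW; apply: derives_trans (derV) _.
by apply: (derives_sub derW _ _ (leqnn _)); exact: subsetUl.
Qed.

Lemma derives_bin D S o x y z cx cy :
  derives D S [set x] cx -> derives D S [set y] cy ->
  (forall t, D t -> arith_eval o (x t) (y t) = Some (z t)) ->
  derives D S [set z] (cx + cy).+1.
Proof.
move=> derx dery ev; rewrite -addn1.
have der1 : derives D (S `|` ([set x] `|` [set y])) [set z] 1.
  by apply: derives_op ev; right; [left|right].
by apply: (derives_sub (derives_trans (derivesU derx dery) der1) _ _ (leqnn _)) => //
  v ->; left; right.
Qed.

Lemma derives_mem D S V : V `<=` S -> derives D S V 0.
Proof. by move=> VS; apply: (derives_sub (@derives0 D S) _ _ _) => // v /VS; left. Qed.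

Lemma derives_sum D S n (F : 'I_n -> val) c : S (cst 0) ->
  (forall i, derives D S [set F i] c) ->
  derives D S [set fun t => \sum_i F i t] (n * c.+1).
Proof.
move=> S0 derF; rewrite -[in (n * _)%N](size_enum_ord n).
rewrite (_ : (fun t => _) = fun t => \sum_(i <- enum 'I_n) F i t); last first.
  by apply/funext => t; rewrite big_enum.
elim: (enum 'I_n) => [|i s IH] /=.
  by apply: derives_mem => _ ->; under eq_fun do rewrite big_nil.
rewrite mulSn addSn; apply: (derives_bin (o := Add) (derF i) IH) => t _ /=.
by rewrite big_cons.
Qed.

End CostCalculus.

(** * Reduction modulo [X^n - s] *)

Section ModXnC.
Variable F : fieldType.

(** Substituting [s] for [X^n] gives the remainder modulo [X^n - s] of a polynomial of size at most
    [2n]. *)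
Definition fold_poly (n : nat) (s : F) (p : {poly F}) :=
  take_poly n p + s *: drop_poly n p.

Lemma size_fold_poly n s (p : {poly F}) :
  (size p <= n + n)%N -> (size (fold_poly n s p) <= n)%N.
Proof.
move=> szp; rewrite (leq_trans (size_polyD _ _))// geq_max size_take_poly.
by rewrite (leq_trans (size_scale_leq _ _))// size_drop_poly leq_subLR.
Qed.

(** Since [X^(2n) - s^2 = (X^n - s)(X^n + s)], the inner reduction changes [p] only by a multiple of
    [X^n - s]. *)
Lemma modp_Xn2_sub (n : nat) (s : F) (p : {poly F}) : (0 < n)%N ->
  (p %% ('X^(n + n) - (s ^+ 2)%:P)) %% ('X^n - s%:P) = p %% ('X^n - s%:P).
Proof.
move=> n0; have dv : 'X^n - s%:P %| 'X^(n + n) - (s ^+ 2)%:P.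
  by rewrite exprD -expr2 polyC_exp subr_sqr dvdp_mulr.
rewrite {2}(divp_eq p ('X^(n + n) - (s ^+ 2)%:P)) modpD.
by rewrite (modp_eq0 (dvdp_mull _ dv)) add0r.
Qed.

Lemma modp_Xn_sub (n : nat) (s : F) (p : {poly F}) : (0 < n)%N ->
  (size p <= n + n)%N ->
  p %% ('X^n - s%:P) = fold_poly n s p.
Proof.
move=> n0 szp; rewrite /fold_poly; apply/esym/(@modpP _ _ (drop_poly n p)).
  rewrite -[LHS](poly_take_drop n) mulrBr -mul_polyC; ring.
rewrite size_XnsubC// ltnS (leq_trans (size_polyD _ _))// geq_max.
rewrite size_take_poly (leq_trans (size_scale_leq _ _))// size_drop_poly leq_subLR //.
Qed.

(** The divide step of the fast product: used with [s] and [-s], it replaces one product of size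
    [2n] by two of size [n]. *)
Lemma fold_mulp_mod (n : nat) (s : F) (p q : {poly F}) : (0 < n)%N ->
  (size p <= n + n)%N -> (size q <= n + n)%N ->
  fold_poly n s ((p * q) %% ('X^(n + n) - (s ^+ 2)%:P))
  = (fold_poly n s p * fold_poly n s q) %% ('X^n - s%:P).
Proof.
move=> n0 szp szq; rewrite -!modp_Xn_sub//; last first.
  rewrite -ltnS -[ltnRHS](size_XnsubC (s ^+ 2) (n := n + n)) ?addn_gt0 ?n0//.
  by rewrite ltn_modp -size_poly_eq0 size_XnsubC ?addn_gt0 ?n0.
by rewrite modp_Xn2_sub// modp_mul [in RHS]mulrC modp_mul [q * p]mulrC.
Qed.

End ModXnC.

(** * Fast products of complex polynomials, counted in real flops *)

Section ComplexConvolution.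
Variables (R : realType) (I : Type).
Local Open Scope classical_set_scope.
Local Notation input := (I -> R).
Local Notation val := (input -> R).
Local Notation cval := (input -> R[i]).
Implicit Types (D : set input) (S : set val) (y z : cval) (f g : input -> {poly R[i]}).

Definition parts z : set val :=
  [set fun t => complex.Re (z t)] `|` [set fun t => complex.Im (z t)].

Lemma parts_sub z S :
  S (fun t => complex.Re (z t)) -> S (fun t => complex.Im (z t)) -> parts z `<=` S.
Proof. by move=> SRe SIm v [->|->]. Qed.

Lemma partsP z S : parts z `<=` S ->
  S (fun t => complex.Re (z t)) /\ S (fun t => complex.Im (z t)).
Proof. by move=> zS; split; apply: zS; [left|right]. Qed.

Lemma parts_cst k S : range (@cst input R) `<=` S -> parts (cst k) `<=` S.
Proof.
move=> cS; apply: parts_sub; apply: cS; last by exists (complex.Im k).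
by exists (complex.Re k).
Qed.

Lemma derives_addC D S y z : parts y `<=` S -> parts z `<=` S ->
  derives D S (parts (y \+ z)) 2.
Proof.
move=> yS zS; have [yRe yIm] := partsP yS; have [zRe zIm] := partsP zS.
apply: (derivesU (derives_op (o := Add) yRe zRe _) (derives_op (o := Add) yIm zIm _)).
  by move=> t _ /=; rewrite raddfD.
by move=> t _ /=; rewrite raddfD.
Qed.

Lemma derives_mulC D S y z : parts y `<=` S -> parts z `<=` S ->
  derives D S (parts (y \* z)) 6.
Proof.
move=> yS zS; have [yRe yIm] := partsP yS; have [zRe zIm] := partsP zS.
have op o (u v w : val) : S u -> S v ->
    (forall t, arith_eval o (u t) (v t) = Some (w t)) -> derives D S [set w] 1.
  by move=> Su Sv ev; apply: (derives_op Su Sv) => t _; exact: ev.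
pose prod (u v : val) : val := fun t => u t * v t.
have mul u v : S u -> S v -> derives D S [set prod u v] 1.
  by move=> Su Sv; exact: (op Mul u v).
apply: (derivesU (c := 3) (c' := 3)).
  apply: (derives_bin (o := Defs.Sub) (mul _ _ yRe zRe) (mul _ _ yIm zIm)) => t _ /=.
  by rewrite /prod; case: (y t) (z t) => [a b] [a' b'].
apply: (derives_bin (o := Add) (mul _ _ yRe zIm) (mul _ _ yIm zRe)) => t _ /=.
by rewrite /prod; case: (y t) (z t) => [a b] [a' b'].
Qed.

(** One shape serves both the folding of a polynomial and the recombination of two foldings. Two
    complex products and one complex sum cost 6 + 6 + 2 flops. *)
Lemma derives_lin D S (k s : R[i]) y z : range (@cst input R) `<=` S ->
  parts y `<=` S -> parts z `<=` S ->
  derives D S (parts (fun t => k * (y t + s * z t))) 14.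
Proof.
move=> cS yS zS; have cS1 V : range (@cst input R) `<=` S `|` V.
  exact: subset_trans cS (@subsetUl _ _ _).
have sub V W : W `<=` S -> W `<=` S `|` V by move/subset_trans; apply; exact: subsetUl.
have d1 : derives D S (parts (cst s \* z)) 6.
  by apply: derives_mulC => //; exact: parts_cst.
have d2 : derives D (S `|` parts (cst s \* z)) (parts (y \+ cst s \* z)) 2.
  by apply: derives_addC; [exact: sub|exact: subsetUr].
have d3 := derives_trans d1 d2; set V := (_ `|` _) in d3.
have d4 : derives D (S `|` V) (parts (cst k \* (y \+ cst s \* z))) 6.
  apply: derives_mulC; first exact: parts_cst (cS1 V).
  by move=> v yv; right; right.
apply: (derives_sub (derives_trans d3 d4) _ _ (leqnn _)) => // v kv.
by left; right.
Qed.

Definition coefs f : set val := \bigcup_i parts (fun t => (f t)`_i).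

(** [coefs] ranges over all degrees, but from degree [n] on the coefficients are the constant 0 and
    cost nothing. *)
Lemma derives_coefs D S n f c : range (@cst input R) `<=` S ->
  (forall t, size (f t) <= n)%N ->
  (forall i : 'I_n, derives D S (parts (fun t => (f t)`_i)) c) ->
  derives D S (coefs f) (n * c).
Proof.
move=> cS szf derf; have := derives_bigcup derf; rewrite card_ord => der.
apply: (derives_sub der _ _ (leqnn _)) => // v [i _ fv].
have [ltin|leni] := ltnP i n; first by left; exists (Ordinal ltin).
right; move: v fv; rewrite (_ : (fun t => _) = cst 0); first exact: parts_cst.
by apply/funext => t /=; rewrite nth_default // (leq_trans _ leni).
Qed.

(** With [n = 2^e], a level of the recursion needs four foldings at [14n] flops, two products of
    size [n], and a recombination at [28n]. The cost thus satisfies [T(2n) = 2 T(n) + 84n] with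
    [T(1) = 6], which the stated bound solves. *)
Lemma derives_mulp_mod e D S (k : R[i]) f g : range (@cst input R) `<=` S -> k != 0 ->
  (forall t, size (f t) <= 2 ^ e)%N -> (forall t, size (g t) <= 2 ^ e)%N ->
  coefs f `<=` S -> coefs g `<=` S ->
  derives D S (coefs (fun t => (f t * g t) %% ('X^(2 ^ e) - k%:P)))
    ((42 * e + 6) * 2 ^ e).
Proof.
have coefS h V i : coefs h `<=` V -> parts (fun t => (h t)`_i) `<=` V.
  by move=> hV v hv; apply: hV; exists i.
elim: e D S k f g => [|e IH] D S k f g cS k0 szf szg fS gS.
  rewrite mulnC; apply: derives_coefs => // [t|i].
    rewrite -ltnS -[ltnRHS](size_XnsubC k (n := 1))// ltn_modp.
    by rewrite -size_poly_eq0 size_XnsubC.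
  rewrite (_ : (fun t => _) = (fun t => (f t)`_0) \* (fun t => (g t)`_0)).
    by apply: derives_mulC; exact: coefS.
  apply/funext => t /=; rewrite ord1 modp_small.
    by rewrite coefM big_ord1.
  rewrite size_XnsubC // ltnS (leq_trans (size_polyMleq _ _))//.
  have := szf t; have := szg t; rewrite expn0.
  by case: (size (g t)) (size (f t)) => [|[]] // [|[]].
set n := (2 ^ e)%N; have n0 : (0 < n)%N by rewrite expn_gt0.
have En : (2 ^ e.+1 = n + n)%N by rewrite expnS mul2n addnn.
rewrite En in szf szg *.
(* Complex coefficients provide a square root at every level. It is nonzero, so the recursion
   applies to [s] and [-s], and division by [2s] is possible. *)
pose s : R[i] := sqrtC k; have s2 : s ^+ 2 = k by rewrite sqrtCK.
have s0 : s != 0 by rewrite sqrtC_eq0.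
have derF V (a : R[i]) (h : input -> {poly R[i]}) :
    range (@cst input R) `<=` V -> (forall t, size (h t) <= n + n)%N ->
    coefs h `<=` V -> derives D V (coefs (fun t => fold_poly n a (h t))) (n * 14).
  move=> cV szh hV; apply: derives_coefs => // [t|i]; first exact: size_fold_poly.
  rewrite (_ : (fun t => _) = fun t => 1 * ((h t)`_i + a * (h t)`_(i + n))).
    by apply: derives_lin => //; exact: coefS.
  apply/funext => t; rewrite coefD coefZ coef_take_poly coef_drop_poly.
  by rewrite ltn_ord mul1r.
have derM (a : R[i]) : a != 0 -> a ^+ 2 = k -> derives D S
    (coefs (fun t => fold_poly n a ((f t * g t) %% ('X^(n + n) - k%:P))))
    (n * 28 + (42 * e + 6) * n).
  move=> a0 a2; have d1 := derivesU (derF S a f cS szf fS) (derF S a g cS szg gS).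
  set V := (_ `|` _) in d1.
  have d2 := IH D (S `|` V) a (fun t => fold_poly n a (f t))
    (fun t => fold_poly n a (g t)).
  apply: (derives_sub (derives_trans d1 (d2 _ _ _ _ _ _)) _ _ _) => //.
  - exact: subset_trans cS (@subsetUl _ _ _).
  - by move=> t; exact: size_fold_poly.
  - by move=> t; exact: size_fold_poly.
  - by move=> v hv; right; left.
  - by move=> v hv; right; right.
  - move=> v [i _ hv]; left; right; exists i => //.
    by under eq_fun do rewrite -fold_mulp_mod// a2.
  - by rewrite leq_add2r -mulnDr.
have ns0 : - s != 0 by rewrite oppr_eq0.
have d1 := derivesU (derM s s0 s2) (derM (- s) ns0 _).
set V := (_ `|` _) in d1; set h := fun t => (f t * g t) %% _.
have cSV : range (@cst input R) `<=` S `|` V := subset_trans cS (@subsetUl _ _ _).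
have foldS (a : R[i]) i : coefs (fun t => fold_poly n a (h t)) `<=` V ->
    parts (fun t => (fold_poly n a (h t))`_i) `<=` S `|` V.
  by move=> aV v av; right; apply: aV; exists i.
have d2 : derives D (S `|` V) (coefs h) ((n + n) * 14).
  apply: derives_coefs => // [t|i].
    rewrite -ltnS -[ltnRHS](size_XnsubC k (n := n + n)) ?addn_gt0 ?n0//.
    by rewrite ltn_modp -size_poly_eq0 size_XnsubC ?addn_gt0 ?n0.
  (* For [h = h0 + h1 X^n] the foldings are [h0 + s h1] and [h0 - s h1]. Half their sum gives the
     low coefficients, their difference divided by [2s] the high ones. *)
  have [ltin|leni] := ltnP i n.
    rewrite (_ : (fun t => _) = fun t => 2^-1 *
        ((fold_poly n s (h t))`_i + 1 * (fold_poly n (- s) (h t))`_i)).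
      by apply: derives_lin => //; apply: foldS => v hv; [left|right].
    apply/funext => t; rewrite !coefD !coefZ !coef_take_poly ltin; field => //.
  rewrite (_ : (fun t => _) = fun t => (2 * s)^-1 *
      ((fold_poly n s (h t))`_(i - n) + (- 1) * (fold_poly n (- s) (h t))`_(i - n))).
    by apply: derives_lin => //; apply: foldS => v hv; [left|right].
  apply/funext => t; rewrite !coefD !coefZ !coef_take_poly !coef_drop_poly subnK//.
  by field.
rewrite sqrrN in d1.
apply: (derives_sub (derives_trans (d1 s2) d2) _ _ _) => //.
  by move=> v hv; left; right.
by lia.
Qed.

End ComplexConvolution.

(** * Hankel products as coefficients of polynomial products *)

Section Correlation.
Variable R : comNzRingType.

(* In [v * rev_poly p] with [v] of size at most [M], the coefficients of degrees
   [M + i] and [i] are the entries [i] of [v, 0]_H p and [0, v]_H p. *)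
Definition rev_poly M (p : 'I_M -> R) : {poly R} := \sum_j p j *: 'X^(M - j).

Lemma size_rev_poly M (p : 'I_M -> R) : (size (rev_poly p) <= M.+1)%N.
Proof.
apply: (leq_trans (size_sum _ _ _)); apply/bigmax_leqP => j _.
by rewrite (leq_trans (size_scale_leq _ _))// size_polyXn ltnS leq_subr.
Qed.

(** Which entry of [p] stands at degree [n] does not depend on [p], so forming the reversed
    polynomial costs no flops. *)
Lemma coef_rev_poly M n :
  (forall p : 'I_M -> R, (rev_poly p)`_n = 0) \/
  exists j, forall p : 'I_M -> R, (rev_poly p)`_n = p j.
Proof.
have coefE p : (rev_poly p)`_n = \sum_(j < M) p j * (n == M - j)%N%:R.
  by rewrite coef_sum; apply: eq_bigr => j _; rewrite coefZ coefXn.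
case: (pickP (fun j : 'I_M => n == M - j)%N) => [j /eqP nj|nMj]; last first.
  by left=> p; rewrite coefE big1// => j _; rewrite nMj mulr0.
right; exists j => p; rewrite coefE (bigD1 j)//= nj eqxx mulr1 big1 ?addr0// => j' j'j.
rewrite (_ : (_ == _) = false) ?mulr0//; apply: contraNF j'j => /eqP Ej.
by apply/eqP/val_inj => /=; have := ltn_ord j; have := ltn_ord j'; lia.
Qed.

Lemma coef_mul_rev_poly M (v : {poly R}) (p : 'I_M -> R) n :
  (v * rev_poly p)`_n =
  \sum_(j < M) (if (n + j < M)%N then 0 else v`_(n + j - M)) * p j.
Proof.
rewrite mulr_sumr coef_sum; apply: eq_bigr => j _.
rewrite -scalerAr coefZ coefMXn mulrC; congr (_ * _).
have jM := ltn_ord j; rewrite (_ : (n < M - j)%N = (n + j < M)%N); last by lia.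
by case: ltnP => // nj; congr (_`__); lia.
Qed.

End Correlation.

(** The columns [rho] of [V] form the identity, so a combination [y *m V] shows its coefficients [y]
    at these positions. *)
Lemma coord_reduced (F : fieldType) r M (V : 'M[F]_(r, M)) (rho : 'I_r -> 'I_M)
    (x : 'rV_M) :
  (forall i i', V i (rho i') = (i == i')%:R) -> (x <= V)%MS ->
  forall j, x 0 j = \sum_i x 0 (rho i) * V i j.
Proof.
move=> Vrho /submxP[y ->] j; rewrite mxE; apply: eq_bigr => i _; congr (_ * _).
rewrite mxE (bigD1 i)//= Vrho eqxx mulr1 big1 ?addr0// => i' /negPf i'i.
by rewrite Vrho i'i mulr0.
Qed.

(** * Real polynomial products and Gauss-Jordan elimination *)

Section Reduction.
Variables (R : realType) (I : Type).
Local Open Scope classical_set_scope.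
Local Notation input := (I -> R).
Local Notation val := (input -> R).
Implicit Types (D : set input) (S : set val).

(** The product has size at most [2M], so reduction modulo [X^(2^e) - 1] leaves it unchanged. It is
    computed over [R[i]] and its real parts are kept. *)
Lemma derives_mulp D S M e (v w : input -> {poly R}) :
  range (@cst input R) `<=` S ->
  (forall t, size (v t) <= M)%N -> (forall t, size (w t) <= M.+1)%N ->
  (M + M < 2 ^ e)%N ->
  (forall i, S (fun t => (v t)`_i)) -> (forall i, S (fun t => (w t)`_i)) ->
  derives D S (range (fun i t => (v t * w t)`_i)) ((42 * e + 6) * 2 ^ e).
Proof.
move=> cS szv szw Me vS wS.
pose emb (x : input -> {poly R}) t := map_poly (real_complex R) (x t).
have embS (x : input -> {poly R}) :
    (forall i, S (fun t => (x t)`_i)) -> coefs (emb x) `<=` S.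
  move=> xS y [i _ [->|->]].
    by under eq_fun do rewrite coef_map/=.
  by under eq_fun do rewrite coef_map/=; apply: cS; exists 0.
have sze (x : input -> {poly R}) n : (forall t, size (x t) <= n)%N -> (n <= 2 ^ e)%N ->
    forall t, (size (emb x t) <= 2 ^ e)%N.
  by move=> szx ne t; rewrite size_map_poly (leq_trans (szx t)).
have N1 : (1 : R[i]) != 0 by exact: oner_neq0.
have der := @derives_mulp_mod R I e D S 1 (emb v) (emb w) cS N1 (sze _ _ szv _)
  (sze _ _ szw _) (embS _ vS) (embS _ wS).
apply: (derives_sub (der _ _) _ _ (leqnn _)) => //; [lia|lia|].
move=> _ [i _ <-]; left; exists i => //; left; apply/funext => t.
rewrite modp_small; first by rewrite -rmorphM coef_map.
rewrite size_XnsubC ?expn_gt0// ltnS -rmorphM size_map_poly.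
apply: (leq_trans (size_polyMleq _ _)).
have := leq_add (szv t) (szw t); move: (_ + size (w t))%N => n; lia.
Qed.

(** Elimination in [l] pivot steps. The pivot positions depend on the branch taken, so the rest of
    the computation is a continuation that has to work for every resulting [V] and [rho]. *)
Lemma solves_reduce r M K (out : 'I_K -> val) D S c (A : input -> 'M[R]_(r, M))
    (j0 : 'I_M) l :
  (l <= r)%N -> range (@cst input R) `<=` S ->
  (forall t, D t -> row_free (A t)) ->
  (forall i j, S (fun t => A t i j)) ->
  (forall D' S' (V : input -> 'M[R]_(r, M)) (rho : 'I_r -> 'I_M),
     D' `<=` D -> S `<=` S' -> (forall i j, S' (fun t => V t i j)) ->
     (forall t, D' t -> (A t <= V t)%MS) ->
     (forall t, D' t -> forall i i' : 'I_r, (i' < l)%N ->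
        V t i (rho i') = (i == i')%:R) ->
     solves out D' S' c) ->
  solves out D S (c + l * (4 * r * M)).
Proof.
move=> + cS freeA AS; elim: l c => [|l IH] c ltlr next.
  (* Before the first step no pivot is prescribed, and any [rho] will do. *)
  by rewrite addn0; apply: (next D S A (fun=> j0)).
rewrite mulSn addnA; apply: IH (ltnW ltlr) _ => D1 S1 V rho sD sS VS AV Vrho.
pose l0 := Ordinal ltlr.
have cS1 : range (@cst input R) `<=` S1 := subset_trans cS sS.
(* A step takes up to [M] zero tests, [M] divisions to normalise the pivot row, and [2rM] flops to
   update the matrix; as [r > 0], this is at most [4rM]. *)
suff: solves out D1 S1 (c + (M + M * r * 2) + size (enum 'I_M)).
  apply: sub_solves => //; rewrite size_enum_ord; nia.
apply: (@solves_find_nonzero _ _ _ _ _ _ _ _ (fun j t => V t l0 j)) => [j _|| j _].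
- exact: VS.
(* No input reaches this leaf: [V] has the full rank of [A], so its row [l0] cannot vanish. *)
- apply: solves_done => j; exists (cst 0); first by apply: cS1; exists 0.
  move=> t [D1t V0]; exfalso; have Vfree : row_free (V t).
    rewrite -row_leq_rank; have := freeA t (sD _ D1t); rewrite /row_free => /eqP {1}<-.
    exact: mxrankS (AV _ D1t).
  have /(row_free_inj Vfree)/eqP : delta_mx 0 l0 *m V t = (0 : 'rV_r) *m V t.
    rewrite mul0mx -rowE; apply/rowP => j'; rewrite !mxE.
    by rewrite V0 // mem_enum.
  by move/eqP/rowP/(_ l0)/eqP; rewrite !mxE !eqxx oner_eq0.
- set D2 := D1 `&` _.
  pose y j' t := V t l0 j' / V t l0 j.
  pose V' t : 'M[R]_(r, M) := \matrix_(i, j')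
     if i == l0 then y j' t else V t i j' - V t i j * y j' t.
  have dery : derives D2 S1 (\bigcup_j' [set y j']) (#|'I_M| * 1).
    apply: derives_bigcup => j'; apply: (derives_op (o := Div) (VS l0 j') (VS l0 j)).
    by move=> t [_ /= /negPf ->].
  have derV : derives D2 (S1 `|` \bigcup_j' [set y j'])
      (\bigcup_ij [set fun t => V' t ij.1 ij.2]) (#|{: 'I_r * 'I_M}| * 2).
    apply: derives_bigcup => -[i j'] /=.
    have [->|il] := eqVneq i l0.
      have d0 : derives D2 (S1 `|` \bigcup_j' [set y j']) [set fun t => V' t l0 j'] 0.
        apply: derives_mem => _ ->; right; exists j' => //=.
        by apply/funext => t; rewrite mxE eqxx.
      exact: derives_sub d0 (@subset_refl _ _) (@subsetUl _ _ _) (leq0n _).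
    have dm : derives D2 (S1 `|` \bigcup_j' [set y j']) [set fun t => V t i j * y j' t] 1.
      by apply: (derives_op (o := Mul) (x := fun t => V t i j) (y := y j')) => //;
        [left; exact: VS|right; exists j'].
    have dV : derives D2 (S1 `|` \bigcup_j' [set y j']) [set fun t => V t i j'] 0.
      by apply: derives_mem => _ ->; left; exact: VS.
    apply: (derives_bin (o := Defs.Sub) dV dm) => t _ /=.
    by rewrite mxE (negPf il).
  have der := derives_trans dery derV.
  rewrite card_prod !card_ord muln1 in der; rewrite addnC (mulnC M r).
  apply: (der _ _ D2 S1) => //.
  apply: (next _ _ V' (fun i => if i == l0 then j else rho i)).
  + by move=> t [/sD].
  + by move=> v /sS; left.
  + by move=> i j'; right; right; exists (i, j').
  + move=> t [D1t /= Vj]; apply: submx_trans (AV _ D1t) _.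
    have rowl : (row l0 (V t) <= V' t)%MS.
      rewrite (_ : row _ _ = V t l0 j *: row l0 (V' t)).
        by rewrite scalemx_sub ?row_sub.
      by apply/rowP => j'; rewrite !mxE eqxx mulrC divfK.
    apply/row_subP => i; have [->//|il] := eqVneq i l0.
    rewrite (_ : row _ _ = row i (V' t) + (V t i j / V t l0 j) *: row l0 (V t)).
      by rewrite addmx_sub ?row_sub// scalemx_sub.
    by apply/rowP => j'; rewrite !mxE (negPf il) /y; field.
  (* Earlier pivot columns survive, because the pivot row is zero there. *)
  + move=> t [D1t /= Vj] i i'; rewrite ltnS leq_eqVlt => i'l; rewrite mxE.
    have [i'E|i'nl] := eqVneq i' l0.
      rewrite i'E; have [_|_] := eqVneq i l0; rewrite /y divff//.
      by rewrite mulr1 subrr.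
    have ltil : (i' < l)%N by case/orP: i'l => // /eqP il; case/eqP: i'nl; exact: val_inj.
    rewrite /y !Vrho// [l0 == i']eq_sym (negPf i'nl) mul0r mulr0 subr0.
    by have [->|//] := eqVneq i l0; rewrite eq_sym (negPf i'nl).
Qed.

End Reduction.

(** * The requested entries of the Hankel product *)

Section MatrixVector.
Variables (R : realType) (k M r : nat).
Local Open Scope classical_set_scope.
Local Notation input := (datum k M r -> R).

Definition seq_entry (t : input) (n : nat) : R :=
  if insub n is Some i then t (InA r i) else 0.

Definition basis_mx (t : input) : 'M[R]_(r, M) := \matrix_(i, j) t (InU k i j).

Definition segment_row (t : input) (m : nat) : 'rV[R]_M :=
  \row_j seq_entry t (m * M + j).

(** For [q = mM + i], the datum of index [q + j] lies in segment [m] as long as [i + j < M], and in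
    segment [m + 1] afterwards. Each segment is expanded in the rows of [V], and the sums over [j]
    and [l] are exchanged. *)
Lemma matvec_reduced (t : input) (V : 'M[R]_(r, M)) (rho : 'I_r -> 'I_M) (q : nat) :
  (0 < M)%N -> (forall i i', V i (rho i') = (i == i')%:R) ->
  (segment_row t (q %/ M) <= V)%MS -> (segment_row t (q %/ M).+1 <= V)%MS ->
  \sum_(l < r) (seq_entry t (q %/ M * M + rho l) *
            (rVpoly (row l V) * rev_poly (fun j => t (InP k r j)))`_(M + q %% M)
        + seq_entry t ((q %/ M).+1 * M + rho l) *
            (rVpoly (row l V) * rev_poly (fun j => t (InP k r j)))`_(q %% M))
  = \sum_(j < M) seq_entry t (q + j) * t (InP k r j).
Proof.
move=> M0 Vrho seg0 seg1; set m := (q %/ M)%N in seg0 seg1 *; set i := (q %% M)%N.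
have iM : (i < M)%N by rewrite ltn_mod.
have qE : q = (m * M + i)%N by exact: divn_eq.
under eq_bigr do rewrite !coef_mul_rev_poly !mulr_sumr -big_split /=.
rewrite exchange_big /=; apply: eq_bigr => j _.
under eq_bigr do rewrite !mulrA -mulrDl.
rewrite -mulr_suml; congr (_ * _).
have jM := ltn_ord j.
have [ijM|Mij] := ltnP (i + j) M.
  transitivity (segment_row t m 0 (Ordinal ijM)); last by rewrite mxE qE addnA.
  rewrite (coord_reduced Vrho seg0); apply: eq_bigr => l _.
  rewrite mulr0 addr0 ifN; last by rewrite -leqNgt -addnA leq_addr.
  rewrite -addnA addKn mxE; congr (_ * _).
  by rewrite -[(i + j)%N]/(nat_of_ord (Ordinal ijM)) coef_rVpoly_ord mxE.
have ijM : (i + j - M < M)%N by lia.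
transitivity (segment_row t m.+1 0 (Ordinal ijM)); last first.
  by rewrite mxE /= qE; congr seq_entry; lia.
rewrite (coord_reduced Vrho seg1); apply: eq_bigr => l _.
rewrite ifN; last by rewrite -leqNgt -addnA leq_addr.
(* Now [i + j] is at least [M], beyond the size of the row polynomial, so the [U] term vanishes. *)
rewrite -addnA addKn [X in _ * X + _]nth_default ?mulr0 ?add0r; last first.
  exact: leq_trans (size_poly _ _) Mij.
rewrite mxE; congr (_ * _).
by rewrite -[(i + j - M)%N]/(nat_of_ord (Ordinal ijM)) coef_rVpoly_ord mxE.
Qed.

(** The three summands pay for the [r] polynomial products, for the [Ks] sums of [r] terms (two
    products, one sum and one accumulation each), and for the elimination. *)
Lemma solves_matvec Ks (idx : 'I_Ks -> 'I_(k * M)) e :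
  (0 < M)%N -> (M + M < 2 ^ e)%N ->
  solves (fun j t => \sum_(l < M) seq_entry t (idx j + l) * t (InP k r l))
    [set t | row_free (basis_mx t) /\
             forall m, (m <= k)%N -> (segment_row t m <= basis_mx t)%MS]
    (@free_vals R (datum k M r))
    (r * ((42 * e + 6) * 2 ^ e) + Ks * (r * 4) + r * (4 * r * M)).
Proof.
move=> M0 Me; set D := [set t | _].
have cF : range (@cst input R) `<=` @free_vals R (datum k M r) by exact: subsetUl.
have inF d : @free_vals R (datum k M r) (fun t => t d) by right; exists d.
have seqF n : @free_vals R (datum k M r) (fun t => seq_entry t n).
  by rewrite /seq_entry; case: insubP => [i _ _|_]; [exact: inF|left; exists 0].
apply: (solves_reduce (A := basis_mx) (Ordinal M0)) => //.
- by move=> t [].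
- by move=> i j; under eq_fun do rewrite mxE; exact: inF.
move=> D' S' V rho sD sS VS AV Vrho.
pose P (t : input) := rev_poly (fun j => t (InP k r j)) : {poly R}.
pose v l t := rVpoly (row l (V t)) : {poly R}.
have cS : range (@cst input R) `<=` S' := subset_trans cF sS.
have derW : derives D' S' (\bigcup_l range (fun n t => (v l t * P t)`_n))
    (#|'I_r| * ((42 * e + 6) * 2 ^ e)).
  apply: derives_bigcup => l; apply: derives_mulp Me _ _ => //.
  - by move=> t; exact: size_poly.
  - by move=> t; exact: size_rev_poly.
  - move=> n; under eq_fun do rewrite coef_rVpoly.
    case: insubP => [j _ _|_]; last by apply: cS; exists 0.
    by under eq_fun do rewrite mxE; exact: VS.
  - move=> n; have [P0|[j Pj]] := coef_rev_poly R M n.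
      by under eq_fun do rewrite P0; apply: cS; exists 0.
    by under eq_fun do rewrite Pj; apply: sS; exact: inF.
set W := (\bigcup_l _) in derW.
pose o (j : 'I_Ks) t := \sum_l
  (seq_entry t (idx j %/ M * M + rho l) * (v l t * P t)`_(M + idx j %% M)
   + seq_entry t ((idx j %/ M).+1 * M + rho l) * (v l t * P t)`_(idx j %% M)).
have dero : derives D' (S' `|` W) (\bigcup_j [set o j]) (#|'I_Ks| * (r * 4)).
  apply: derives_bigcup => j; apply: derives_sum => [|l].
    by left; apply: cS; exists 0.
  have prod n n' : derives D' (S' `|` W)
      [set fun t => seq_entry t n * (v l t * P t)`_n'] 1.
    apply: (derives_op (o := Mul) (x := fun t => seq_entry t n)
      (y := fun t => (v l t * P t)`_n')) => //; first by left; exact: sS.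
    by right; exists l => //; exists n'.
  exact: (derives_bin (o := Add) (prod _ _) (prod _ _)).
have der := derives_trans derW dero; rewrite !card_ord in der.
rewrite -[X in solves _ _ _ X]addn0; apply: (der _ _ D' S') => //.
apply: solves_done => j; exists (o j); first by right; right; exists j.
move=> t D't; have [_ segA] := sD _ D't.
(* The strict bound ensures that the next segment, of index at most [k], also lies in the span. *)
have jk : (idx j %/ M < k)%N by rewrite ltn_divLR.
apply: matvec_reduced => //; first by move=> i i'; apply: Vrho => //; exact: ltn_ord.
- by apply: submx_trans (AV _ D't); apply: segA; exact: ltnW.
- by apply: submx_trans (AV _ D't); exact: segA.
Qed.

End MatrixVector.

(** * From the vector space hypotheses to row spaces *)

Section Inputs.
Variables (R : realType) (k M r : nat).

Lemma basis_row_free (a : nat -> R) (u : r.-tuple 'cV[R]_M) (p : 'cV[R]_M) :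
  free u -> row_free (basis_mx (datum_val (k := k) a u p)).
Proof.
move=> /freeP freeu; apply: inj_row_free => y yA0; apply/rowP => i; rewrite mxE.
apply: freeu => {i}; apply/colP => j; rewrite mxE summxE.
have := congr1 (fun x : 'rV_M => x 0 j) yA0; rewrite !mxE => yAj; rewrite -[RHS]yAj.
by apply: eq_bigr => i _; rewrite !mxE -tnth_nth.
Qed.

Lemma segment_row_sub (a : nat -> R) (u : r.-tuple 'cV[R]_M) (p : 'cV[R]_M) m :
  basis_of (segment_span k M a) u -> (m <= k)%N ->
  (segment_row (datum_val (k := k) a u p) m <= basis_mx (datum_val (k := k) a u p))%MS.
Proof.
move=> /span_basis spanu mk.
have : segment M a m \in <<u>>%VS.
  by rewrite spanu memv_span// map_f// mem_iota.
move=> /coord_span segE; apply/submxP.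
exists (\row_i coord u i (segment M a m)); apply/rowP => j; rewrite !mxE.
have := congr1 (fun x : 'cV_M => x j 0) segE; rewrite mxE summxE => jE.
rewrite /seq_entry insubT /=; first by have := ltn_ord j; nia.
move=> lt_mj; rewrite jE; apply: eq_bigr => i _.
by rewrite !mxE -tnth_nth.
Qed.

End Inputs.

(** * The asymptotic bound and the theorem *)

Lemma flop_bound (R : realType) (c : R) (r M Ks t : nat) :
  (0 < t)%N -> (2 ^ t <= M)%N -> Ks%:R <= c * (r * M)%:R ->
  (r * ((42 * t.+2 + 6) * 2 ^ t.+2) + Ks * (r * 4) + r * (4 * r * M) + Ks)%:R <=
  (528 / ln 2 + 4 + 5 * `|c|) * (r%:R * M%:R * ln M%:R + r%:R ^+ 2 * M%:R) :> R.
Proof.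
move=> t0 tM Ksc; have M1 : (1 <= M)%N by rewrite (leq_trans _ tM)// expn_gt0.
have ln2 : 0 < ln 2 :> R by rewrite ln_gt0// ltr1n.
have lnM : t%:R <= ln M%:R / ln 2 :> R.
  rewrite ler_pdivlMr// mulr_natl -lnXn ?ltr0n//.
  by rewrite ler_ln ?posrE ?exprn_gt0 ?ltr0n// -natrX ler_nat.
have lnM0 : 0 <= ln M%:R :> R by rewrite ln_ge0// ler1n.
have Ksc' : Ks%:R <= `|c| * (r%:R * M%:R) :> R.
  rewrite -natrM (le_trans Ksc)// ler_wpM2r ?ler0n//; exact: ler_norm.
have Ksr : (Ks * r * 4 + Ks)%:R <= 5 * `|c| * (r%:R ^+ 2 * M%:R) :> R.
  (* For [r = 0] the hypothesis forces [Ks = 0]; otherwise [4r + 1] is at most [5r]. *)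
  case: r Ksc' {Ksc} => [|r'] Ksc'.
    by move: Ksc'; rewrite mul0r mulr0 lern0 => /eqP ->; rewrite expr0n/= mul0r mulr0.
  apply: (@le_trans _ _ (5 * (Ks%:R * r'.+1%:R))).
    by rewrite -!natrM ler_nat; nia.
  rewrite -[leRHS]mulrA ler_wpM2l// expr2.
  rewrite (_ : `|c| * _ = `|c| * (r'.+1%:R * M%:R) * r'.+1%:R); last by ring.
  by rewrite ler_wpM2r.
have FFT : (r * ((42 * t.+2 + 6) * 2 ^ t.+2))%:R <=
    528 / ln 2 * (r%:R * M%:R * ln M%:R) :> R.
  (* Here [42(t + 2) + 6] is at most [132t] because [t] is positive, and [2^(t + 2)] is at most
     [4M]; 528 is [132 * 4]. *)
  apply: (@le_trans _ _ (528 * (r * M * t))%:R).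
    rewrite ler_nat (_ : (528 * _ = r * (132 * t * (4 * M)))%N); last by ring.
    by rewrite leq_mul2l; apply/orP; right; apply: leq_mul; rewrite ?expnS; lia.
  rewrite (_ : _ / _ * _ = 528 * (r%:R * M%:R) * (ln M%:R / ln 2)); last by ring.
  by rewrite !natrM mulrA; apply: ler_wpM2l lnM; rewrite !mulr_ge0 ?ler0n.
have X0 : 0 <= r%:R * M%:R * ln M%:R :> R by rewrite !mulr_ge0.
have Y0 : 0 <= r%:R ^+ 2 * M%:R :> R by rewrite mulr_ge0 ?exprn_ge0.
have c0 : 0 <= `|c| by [].
have c1 : 0 <= 528 / ln 2 :> R by exact: divr_ge0 (ler0n _ 528) (ltW ln2).
set X := r%:R * M%:R * ln M%:R in FFT X0 *; set Y := r%:R ^+ 2 * M%:R in Ksr Y0 *.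
have -> : (r * ((42 * t.+2 + 6) * 2 ^ t.+2) + Ks * (r * 4) + r * (4 * r * M) + Ks)%:R
   = (r * ((42 * t.+2 + 6) * 2 ^ t.+2))%:R + (Ks * r * 4 + Ks)%:R + 4 * Y :> R.
  rewrite /Y -natrX -!natrM -!natrD; congr (_%:R); ring.
nra.
Qed.

Theorem theorem2 (R : realType) (c : R) :
  exists C : R,
  forall (Nx M k r Ks : nat) (idx : 'I_Ks -> 'I_(k * M)),
    (0 < Nx)%N -> M = (2 * Nx)%N -> (0 < k)%N ->
    Ks%:R <= c * (r * M)%:R ->
  exists P : program R (datum k M r),
  forall (n : nat) (T sigma : R) (f : R -> R) (V : R -> R -> R)
         (w : 'I_n.+1 -> R) (mu : 'I_M -> R) (ax : R)
         (F Phi : nat -> R -> R) (u : r.-tuple 'cV[R]_M),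
    let a := step_data Phi ax Nx k in
    let p := kernel_vec T sigma n Nx mu ax in
    let s := hankel_rect k M a *m p in
    (0 < n)%N -> (k <= n)%N -> 0 < T -> 0 < sigma -> 0 < ax ->
    (forall x, 0 <= f x) -> potential_bounded_below T V ->
    iteration T sigma f V w Nx mu ax F Phi ->
    basis_of (segment_span k M a) u ->
    basis_of (block_span k M a) (Qfamily u) ->
    computes_within P (datum_val a u p) (fun j => s (idx j) 0)
      (C * (r%:R * M%:R * ln M%:R + r%:R ^+ 2 * M%:R)).
Proof.
exists (528 / ln 2 + 4 + 5 * `|c|) => Nx M k r Ks idx Nx0 ME k0 Ksc.
have M1 : (1 < M)%N by rewrite ME; lia.
have /andP[tM Mt] := trunc_log_bounds (ltnSn 1) (ltnW M1).
have t0 : (0 < trunc_log 2 M)%N by rewrite trunc_log_gt0.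
set t := trunc_log 2 M in tM Mt t0.
(* From [M < 2^(t + 1)], the transform length [2^(t + 2)] exceeds [2M] and is still at most [4M]. *)
have Me : (M + M < 2 ^ t.+2)%N by rewrite expnS; lia.
have [P HP] := solves_computes (solves_matvec R r idx (ltnW M1) Me).
exists P => n T sigma f V w mu ax F Phi u a p s _ _ _ _ _ _ _ _ basisu _.
have [|mem [cost [ex outE costle]]] := HP (datum_val a u p).
  split; first exact: basis_row_free (basis_free basisu).
  by move=> m mk; exact: segment_row_sub.
exists mem, cost; split=> // [j|]; last exact: le_trans costle (flop_bound t0 tM Ksc).
(* The index [idx j + l] is below [(k + 1)M], so the default value of [seq_entry] is not reached. *)
rewrite outE mxE; apply: eq_bigr => l _; rewrite mxE /seq_entry insubT//.
have := ltn_ord (idx j); have := ltn_ord l; rewrite mulSn; lia.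
Qed.
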